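(* Let $M,n\ge 1$ be integers and let $\Phi_1,\dots,\Phi_M:\{1,\dots,n\}\to S^2$ be $M$ configurations of $n$ points on the sphere $S^2\subset\mathbb{R}^3$. Let $((g_1,\dots,g_M),\Theta)$ be a solution of the spherical Procrustes problem for $\Phi_1,\dots,\Phi_M$, and let $((g'_1,\dots,g'_M),\Psi)$ be a solution of the $O(3)$ Procrustes problem in $\mathbb{R}^3$ for the same configurations. Let $\Theta'$ be the projection of $\Psi$ back to $S^2$, i.e. $\Theta'(j)=\Psi(j)/\|\Psi(j)\|$ for $j=1,\dots,n$ (where $\Psi(j)\neq 0$ for all $j$, so that the projection is defined). Then $$\inf_{h\in O(3)} d_{(S^2)^n}(h\cdot\Theta,\Theta')\;\le\;(1+\pi)\sqrt{L^*},$$ where $L^*=L(g_1,\dots,g_M,\Theta)$ is the minimal value of the spherical Procrustes loss functional.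
   Context: $S^2\subset\mathbb{R}^3$ is the unit sphere, $d_{S^2}$ is the geodesic (great-circle) distance on it, and $\|\cdot\|$ is the Euclidean norm on $\mathbb{R}^3$. A configuration of $n$ points on $S^2$ is a map $\{1,\dots,n\}\to S^2$, equivalently an element of $(S^2)^n$; $O(3)$ acts on configurations pointwise, $(h\cdot\Theta)(j)=h\,\Theta(j)$. For configurations $\Xi,\Xi'$ on $S^2$, $$d_{(S^2)^n}(\Xi,\Xi')=\Big(\sum_{j=1}^n d_{S^2}(\Xi(j),\Xi'(j))^2\Big)^{1/2},$$ and for maps $\Xi,\Xi':\{1,\dots,n\}\to\mathbb{R}^3$, $$d_{(\mathbb{R}^3)^n}(\Xi,\Xi')=\Big(\sum_{j=1}^n \|\Xi(j)-\Xi'(j)\|^2\Big)^{1/2}.$$ Spherical (generalized) Procrustes problem: find rotations $R_1,\dots,R_M\in SO(3)$ and a centroid configuration $\Theta:\{1,\dots,n\}\to S^2$ minimizing the loss $$L(R_1,\dots,R_M,\Theta)=\frac1M\sum_{i=1}^M\sum_{j=1}^n d_{S^2}\big(R_i\Phi_i(j),\Theta(j)\big)^2 .$$ $O(3)$ Procrustes problem in $\mathbb{R}^3$: regarding each $\Phi_i$ as a map into $\mathbb{R}^3$, find $h_1,\dots,h_M\in O(3)$ and a configuration $\Xi:\{1,\dots,n\}\to\mathbb{R}^3$ (not constrained to lie on the sphere) minimizing $$L_{\mathbb{R}^3}((h_1,\dots,h_M),\Xi)=\frac1M\sum_{i=1}^M d_{(\mathbb{R}^3)^n}(h_i\cdot\Phi_i,\Xi)^2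 .$$ In both problems, a solution means a global minimizer. *)

(* Defs.v *)
From HB Require Import structures.
From mathcomp Require Import all_boot all_order all_algebra.
From mathcomp Require Import all_classical all_reals all_analysis.

Set Implicit Arguments.
Unset Strict Implicit.
Unset Printing Implicit Defensive.

Import Order.TTheory GRing.Theory Num.Theory.

Local Open Scope classical_set_scope.
Local Open Scope ring_scope.

Section Procrustes.
Variable R : realType.

Definition dot3 (x y : 'cV[R]_3) : R := \sum_k x k 0 * y k 0.

(* The Euclidean norm; the norm `|x| that MathComp-Analysis puts on matrices
   is the sup norm. *)
Definition enorm (x : 'cV[R]_3) : R := Num.sqrt (dot3 x x).

Definition S2 : set 'cV[R]_3 := [set x | enorm x = 1].

Definition O3 : set 'M[R]_3 := [set h | h^T *m h = 1%:M].

Definition SO3 : set 'M[R]_3 := [set h | O3 h /\ \det h = 1].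

(* The great-circle distance is the angle between unit vectors, so this is
   meaningful only for x and y in S2. *)
Definition dS2 (x y : 'cV[R]_3) : R := acos (dot3 x y).

(* A configuration of n points is a map 'I_n -> 'cV[R]_3; lying on the sphere
   is a separate predicate, so that the same map can also be viewed as a
   configuration in R^3. *)
Definition spherical n (X : 'I_n -> 'cV[R]_3) : Prop := forall j, S2 (X j).

Definition act n (h : 'M[R]_3) (X : 'I_n -> 'cV[R]_3) : 'I_n -> 'cV[R]_3 :=
  fun j => h *m X j.

Definition dS2n n (X Y : 'I_n -> 'cV[R]_3) : R :=
  Num.sqrt (\sum_j dS2 (X j) (Y j) ^+ 2).

Definition dR3n n (X Y : 'I_n -> 'cV[R]_3) : R :=
  Num.sqrt (\sum_j enorm (X j - Y j) ^+ 2).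

Definition sphere_loss M n (Phi : 'I_M -> 'I_n -> 'cV[R]_3)
    (g : 'I_M -> 'M[R]_3) (Theta : 'I_n -> 'cV[R]_3) : R :=
  M%:R^-1 * \sum_i \sum_j dS2 (g i *m Phi i j) (Theta j) ^+ 2.

Definition sphere_solution M n (Phi : 'I_M -> 'I_n -> 'cV[R]_3)
    (g : 'I_M -> 'M[R]_3) (Theta : 'I_n -> 'cV[R]_3) : Prop :=
  [/\ forall i, SO3 (g i), spherical Theta &
      forall (f : 'I_M -> 'M[R]_3) (X : 'I_n -> 'cV[R]_3),
        (forall i, SO3 (f i)) -> spherical X ->
        sphere_loss Phi g Theta <= sphere_loss Phi f X].

Definition euclidean_loss M n (Phi : 'I_M -> 'I_n -> 'cV[R]_3)
    (h : 'I_M -> 'M[R]_3) (Xi : 'I_n -> 'cV[R]_3) : R :=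
  M%:R^-1 * \sum_i dR3n (act (h i) (Phi i)) Xi ^+ 2.

Definition euclidean_solution M n (Phi : 'I_M -> 'I_n -> 'cV[R]_3)
    (h : 'I_M -> 'M[R]_3) (Xi : 'I_n -> 'cV[R]_3) : Prop :=
  (forall i, O3 (h i)) /\
  forall (f : 'I_M -> 'M[R]_3) (X : 'I_n -> 'cV[R]_3),
    (forall i, O3 (f i)) ->
    euclidean_loss Phi h Xi <= euclidean_loss Phi f X.

Definition sphere_proj n (X : 'I_n -> 'cV[R]_3) : 'I_n -> 'cV[R]_3 :=
  fun j => (enorm (X j))^-1 *: X j.

End Procrustes.

Arguments S2 {R}.
Arguments O3 {R}.
Arguments SO3 {R}.

(* Main.v *)
(** Since chord <= angle, the euclidean loss at the spherical solution is at
    most [L*], hence so is the minimal euclidean loss.  Radial projection to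
    the sphere at most doubles the distance to a point of the sphere, and
    angle <= (pi/2) chord, so with [Theta'] the projection of [Psi] we have
    [dS2 (g'_i Phi_i(j)) (Theta'(j)) <= pi |g'_i Phi_i(j) - Psi(j)|].  For
    [h_i = g'_i g_i^-1], the triangle inequality through [g'_i Phi_i] bounds
    [dS2n (h_i Theta) Theta'], and averaging the squares over [i] bounds the
    infimum. *)
Require Import Defs.
From mathcomp Require Import all_boot all_order all_algebra.
From mathcomp Require Import all_classical all_reals all_analysis.
From mathcomp Require Import ring lra.

Import Order.TTheory GRing.Theory Num.Theory.
Import numFieldNormedType.Exports.

Local Open Scope classical_set_scope.
Local Open Scope ring_scope.

(** * Comparison of angles with chords, in terms of [acos] *)

Section Angles.
Set Implicit Arguments.
Unset Strict Implicit.
Context {R : realType}.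
Implicit Types s t x y z : R.

Lemma sin_le_id t : 0 <= t -> sin t <= t.
Proof.
move=> t0; have [|c _] := @MVT_segment R sin cos 0 t t0 (fun x _ => is_derive_sin x).
  exact/continuous_subspaceT/continuous_sin.
by rewrite sin0 !subr0 => ->; rewrite ler_piMl ?cos_le1.
Qed.

(** Concavity of the sine on [[0, pi / 2]]: its mean slope on [[0, t]] exceeds its mean slope on
    [[t, pi / 2]]. *)
Lemma jordan_sin_ge t : 0 <= t <= pi / 2 -> t <= pi / 2 * sin t.
Proof.
move=> /andP[]; rewrite le_eqVlt => /predU1P[<- _|t0]; first by rewrite sin0 mulr0.
rewrite le_eqVlt => /predU1P[->|t1]; first by rewrite sin_pihalf mulr1.
have pi0 := pi_gt0 R.
have csin (A : set R) : {within A, continuous (@sin R)}.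
  exact/continuous_subspaceT/continuous_sin.
have [c c_in] := MVT t0 (fun x _ => is_derive_sin x) (csin _).
have [d d_in] := MVT t1 (fun x _ => is_derive_sin x) (csin _).
move: c_in d_in; rewrite !in_itv/= => /andP[c0 ct] /andP[td d1].
rewrite sin0 sin_pihalf !subr0 => Ed Ec.
have cd : cos d < cos c by rewrite ltr_cos ?in_itv/=; lra.
(* Adding [Ec] and [Ed] gives [1 = t * cos c + (pi / 2 - t) * cos d], where [cos d < cos c]. *)
rewrite Ec; suff : 1 <= pi / 2 * cos c by nra.
nra.
Qed.

Lemma cos_double_half x : cos x = 1 - 2 * sin (x / 2) ^+ 2.
Proof.
have {1}-> : x = (x / 2) *+ 2 by rewrite mulr2n; lra.
by rewrite cos_mulr2n cos2sin2 mulr2n; ring.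
Qed.

(* [2 - 2 * s] is the squared chord subtending the angle [acos s]. *)
Lemma chord_le_acos s : -1 <= s <= 1 -> 2 - 2 * s <= acos s ^+ 2.
Proof.
move=> hs; have [/andP[a0 api] sE] := acos_def hs.
rewrite -{1}sE cos_double_half.
have := @sin_le_id (acos s / 2) ltac:(lra).
have := @sin_ge0_pi R (acos s / 2) ltac:(lra).
nra.
Qed.

(** Here [(1 - s) / 2] is the squared sine of half the angle, so this is Jordan's inequality at
    [acos s / 2], squared. *)
Lemma acos_le_chord s : -1 <= s <= 1 -> acos s ^+ 2 <= pi ^+ 2 * ((1 - s) / 2).
Proof.
move=> hs; have [/andP[a0 api] sE] := acos_def hs.
rewrite -{2}sE cos_double_half.
have := @jordan_sin_ge (acos s / 2) ltac:(lra).
set u := sin _ => hu.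
have -> : pi ^+ 2 * ((1 - (1 - 2 * u ^+ 2)) / 2) = (pi * u) ^+ 2 :> R by field.
by rewrite lerXn2r ?nnegrE; lra.
Qed.

(** The last hypothesis bounds [z - x * y] by the product of the sines of [acos x] and [acos y],
    hence [z >= cos (acos x + acos y)] by the addition formula. *)
Lemma acos_triangle x y z : -1 <= x <= 1 -> -1 <= y <= 1 -> -1 <= z <= 1 ->
  (z - x * y) ^+ 2 <= (1 - x ^+ 2) * (1 - y ^+ 2) ->
  acos z <= acos x + acos y.
Proof.
move=> hx hy hz hxyz.
have [/andP[x0 xpi] xE] := acos_def hx.
have [/andP[y0 ypi] yE] := acos_def hy.
have [/andP[z0 zpi] zE] := acos_def hz.
(* The cosine reverses order only on [[0, pi]]; a larger sum bounds [acos z] trivially. *)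
have [|lt_pi] := leP pi (acos x + acos y); first exact: le_trans.
rewrite leNgt -ltr_cos ?in_itv/= ?zE; try lra.
rewrite cosD xE yE !sin_acos// -sqrtrM; last by nra.
rewrite -leNgt lerBlDr -lerBlDl.
by rewrite (le_trans (ler_norm _))// -sqrtr_sqr ler_wsqrtr// -sqrrN opprB.
Qed.

End Angles.

(** * Dot product, orthogonal matrices and the great-circle metric *)

Section Sphere.
Set Implicit Arguments.
Unset Strict Implicit.
Context {R : realType}.
Implicit Types (x y z : 'cV[R]_3) (h : 'M[R]_3) (a : R).

Lemma dot3C x y : dot3 x y = dot3 y x.
Proof. by apply: eq_bigr => k _; rewrite mulrC. Qed.

Lemma dot3Bl x y z : dot3 (x - y) z = dot3 x z - dot3 y z.
Proof. by rewrite -sumrB; apply: eq_bigr => k _; rewrite !mxE mulrBl. Qed.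

Lemma dot3Zl a x y : dot3 (a *: x) y = a * dot3 x y.
Proof. by rewrite mulr_sumr; apply: eq_bigr => k _; rewrite !mxE mulrA. Qed.

Lemma dot3Br x y z : dot3 x (y - z) = dot3 x y - dot3 x z.
Proof. by rewrite dot3C dot3Bl !(dot3C x). Qed.

Lemma dot3Zr a x y : dot3 x (a *: y) = a * dot3 x y.
Proof. by rewrite dot3C dot3Zl dot3C. Qed.

Lemma dot3_ge0 x : 0 <= dot3 x x.
Proof. by apply: sumr_ge0 => k _; rewrite -expr2 sqr_ge0. Qed.

Lemma dot3_gt0 x : x != 0 -> 0 < dot3 x x.
Proof.
apply: contraNT; rewrite lt_neqAle dot3_ge0 andbT negbK eq_sym.
rewrite psumr_eq0 => [/allP x0|k _]; last by rewrite -expr2 sqr_ge0.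
apply/eqP/colP => k; rewrite mxE; apply/eqP.
by have := x0 k (mem_index_enum _); rewrite -expr2 sqrf_eq0.
Qed.

Lemma dot3_mull h x y : dot3 (h *m x) y = dot3 x (h^T *m y).
Proof.
have dotE u v : dot3 u v = (u^T *m v) 0 0 :> R.
  by rewrite mxE; apply: eq_bigr => k _; rewrite mxE.
by rewrite !dotE trmx_mul mulmxA.
Qed.

Lemma dot3_cauchy_schwarz x y : dot3 x y ^+ 2 <= dot3 x x * dot3 y y.
Proof.
rewrite /dot3 !big_ord_recl !big_ord0 !addr0.
move: (x 0 0) (y 0 0) (x (lift ord0 0) 0) (y (lift ord0 0) 0).
move: (x _ 0) (y _ 0) => x3 y3 x1 y1 x2 y2.
rewrite -subr_ge0.
(* Lagrange's identity: the defect is the squared norm of the cross product. *)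
have -> : (x1 * x1 + (x2 * x2 + x3 * x3)) * (y1 * y1 + (y2 * y2 + y3 * y3)) -
    (x1 * y1 + (x2 * y2 + x3 * y3)) ^+ 2 =
    (x1 * y2 - x2 * y1) ^+ 2 + (x1 * y3 - x3 * y1) ^+ 2 +
    (x2 * y3 - x3 * y2) ^+ 2 by ring.
by rewrite !addr_ge0 ?sqr_ge0.
Qed.

Lemma enorm_sqr x : enorm x ^+ 2 = dot3 x x.
Proof. by rewrite sqr_sqrtr ?dot3_ge0. Qed.

Lemma S2P x : S2 x <-> dot3 x x = 1.
Proof.
split=> [x1|x1]; first by rewrite -enorm_sqr x1 expr1n.
by rewrite /S2/= /enorm x1 sqrtr1.
Qed.

Lemma S2_dot3_itv x y : S2 x -> S2 y -> -1 <= dot3 x y <= 1.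
Proof.
move=> /S2P x1 /S2P y1; rewrite -ler_norml -(@expr_le1 _ 2)// real_normK ?num_real//.
by rewrite (le_trans (dot3_cauchy_schwarz _ _))// x1 y1 mulr1.
Qed.

Lemma S2_mul h x : O3 h -> S2 x -> S2 (h *m x).
Proof. by move=> hO /S2P x1; apply/S2P; rewrite dot3_mull mulmxA hO mul1mx. Qed.

Lemma S2_normalize x : x != 0 -> S2 ((enorm x)^-1 *: x).
Proof.
move=> /dot3_gt0 x0; apply/S2P; rewrite dot3Zl dot3Zr mulrA -expr2 exprVn.
by rewrite enorm_sqr mulVf// gt_eqF.
Qed.

Lemma O3_1 : O3 (1%:M : 'M[R]_3).
Proof. by rewrite /O3/= trmx1 mul1mx. Qed.

Lemma O3_mul h (k : 'M[R]_3) : O3 h -> O3 k -> O3 (h *m k).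
Proof. by rewrite /O3/= => hO kO; rewrite trmx_mul mulmxA -(mulmxA _ _ h) hO mulmx1. Qed.

Lemma O3_tr h : O3 h -> O3 h^T.
Proof. by rewrite /O3/= trmxK => /mulmx1C. Qed.

Lemma dS2C x y : dS2 x y = dS2 y x.
Proof. by rewrite /dS2 dot3C. Qed.

Lemma dS2_ge0 x y : S2 x -> S2 y -> 0 <= dS2 x y.
Proof. by move=> xS yS; rewrite acos_ge0// S2_dot3_itv. Qed.

Lemma dS2_mul h x y : O3 h -> dS2 (h *m x) (h *m y) = dS2 x y.
Proof. by move=> hO; rewrite /dS2 dot3_mull mulmxA hO mul1mx. Qed.

(* Gram: [z.x - (x.y)(y.z)] is the dot product of the components of [x] and
   [z] orthogonal to [y], whose squared lengths are [1 - (x.y)^2] and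
   [1 - (y.z)^2]. *)
Lemma dS2_triangle y x z : S2 x -> S2 y -> S2 z -> dS2 x z <= dS2 x y + dS2 y z.
Proof.
move=> xS yS zS; apply: acos_triangle; try exact: S2_dot3_itv.
move: xS yS zS => /S2P x1 /S2P y1 /S2P z1.
have := dot3_cauchy_schwarz (x - dot3 x y *: y) (z - dot3 y z *: y).
rewrite !(dot3Bl, dot3Br, dot3Zl, dot3Zr) x1 y1 z1 (dot3C y x) (dot3C z y).
set a := dot3 x y; set b := dot3 y z; set c := dot3 x z => H.
rewrite (_ : c - a * b = c - b * a - a * (b - b * 1)); last ring.
by apply: le_trans H _; rewrite le_eqVlt; apply/orP/or_introl/eqP; ring.
Qed.

Lemma enorm_sub_le_dS2 x y : S2 x -> S2 y -> enorm (x - y) ^+ 2 <= dS2 x y ^+ 2.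
Proof.
move=> xS yS; apply: le_trans (chord_le_acos (S2_dot3_itv xS yS)).
move/S2P: xS => x1; move/S2P: yS => y1.
by rewrite enorm_sqr !(dot3Bl, dot3Br) x1 y1 (dot3C y x); lra.
Qed.

Lemma dS2_normalize_le x y : S2 x -> y != 0 ->
  dS2 x ((enorm y)^-1 *: y) ^+ 2 <= pi ^+ 2 * enorm (x - y) ^+ 2.
Proof.
move=> xS y0; have uS := S2_normalize y0.
have /andP[sl su] := S2_dot3_itv xS uS.
apply: le_trans (acos_le_chord (S2_dot3_itv xS uS)) _.
rewrite ler_wpM2l ?sqr_ge0// enorm_sqr !(dot3Bl, dot3Br) (dot3C y x).
have r0 : 0 < enorm y by rewrite sqrtr_gt0 dot3_gt0.
have -> : dot3 x y = enorm y * dot3 x ((enorm y)^-1 *: y).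
  by rewrite dot3Zr mulVKf// gt_eqF.
move/S2P: xS => ->; rewrite -enorm_sqr.
set s := dot3 _ _ in sl su *; set r := enorm y in r0 *.
(* The goal is [(1 - s) / 2 <= 1 - 2 * r * s + r ^+ 2]. The right side is
   [(r - s) ^+ 2 + (1 - s) * (1 + s)], at least [1 - s] if [s >= 0]; if [s < 0] it is at least 1. *)
have := sqr_ge0 (r - s); have [] := leP 0 s; nra.
Qed.

End Sphere.

(** * Comparison of the two losses *)

Section Comparison.
Set Implicit Arguments.
Unset Strict Implicit.
Context {R : realType} {M n : nat}.
Variable Phi : 'I_M -> 'I_n -> 'cV[R]_3.
Hypothesis PhiS : forall i, spherical (Phi i).

Lemma euclidean_lossE (h : 'I_M -> 'M[R]_3) (X : 'I_n -> 'cV[R]_3) :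
  euclidean_loss Phi h X =
  M%:R^-1 * \sum_i \sum_j enorm (h i *m Phi i j - X j) ^+ 2.
Proof.
congr (_ * _); apply: eq_bigr => i _.
by rewrite sqr_sqrtr// sumr_ge0// => j _; rewrite sqr_ge0.
Qed.

(** Chord <= angle, term by term; this lets the spherical minimizer compete in the Euclidean
    problem. *)
Lemma euclidean_loss_le_sphere (h : 'I_M -> 'M[R]_3) (X : 'I_n -> 'cV[R]_3) :
  (forall i, O3 (h i)) -> spherical X ->
  euclidean_loss Phi h X <= sphere_loss Phi h X.
Proof.
move=> hO XS; rewrite euclidean_lossE ler_wpM2l ?invr_ge0//.
apply: ler_sum => i _; apply: ler_sum => j _.
by apply: enorm_sub_le_dS2 => //; apply: S2_mul => //; apply: PhiS.
Qed.

(* The convexity bound [(a + pi e)^2 <= (1 + pi) (a^2 + pi e^2)], summed over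
   [j], makes Minkowski's inequality unnecessary. *)
Lemma dS2n_transfer_le (h k : 'M[R]_3) i (X Y : 'I_n -> 'cV[R]_3) :
  O3 h -> O3 k -> spherical X -> (forall j, Y j != 0) ->
  dS2n (act (k *m h^T) X) (sphere_proj Y) ^+ 2 <=
  (1 + pi) * (\sum_j dS2 (h *m Phi i j) (X j) ^+ 2 +
              pi * \sum_j enorm (k *m Phi i j - Y j) ^+ 2).
Proof.
move=> hO kO XS Y0; rewrite sqr_sqrtr; last first.
  by rewrite sumr_ge0// => j _; rewrite sqr_ge0.
rewrite mulr_sumr -big_split/= mulr_sumr; apply: ler_sum => j _.
have khO : O3 (k *m h^T) by apply: O3_mul => //; apply: O3_tr.
have pS := PhiS i j; have uS := S2_normalize (Y0 j).
(* The intermediate point is [k *m Phi i j]. In the first distance [k] cancels, and moving [h^T]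
   across the dot product turns it into a term of the spherical loss. *)
have tri := dS2_triangle (S2_mul khO (XS j)) (S2_mul kO pS) uS.
rewrite -mulmxA dS2_mul// in tri.
have E : dS2 (h^T *m X j) (Phi i j) = dS2 (h *m Phi i j) (X j).
  by rewrite dS2C /dS2 dot3_mull.
rewrite E in tri.
have b2 := dS2_normalize_le (S2_mul kO pS) (Y0 j).
have d0 := dS2_ge0 (S2_mul khO (XS j)) uS.
have b0 := dS2_ge0 (S2_mul kO pS) uS.
have a0 := dS2_ge0 (S2_mul hO pS) (XS j).
have e0 : 0 <= enorm (k *m Phi i j - Y j) by exact: sqrtr_ge0.
have pi0 := pi_gt0 R.
rewrite /act /sphere_proj -mulmxA in d0 *.
move: d0 b0 a0 e0 b2 tri.
set d := dS2 _ _; set b := dS2 (k *m _) _; set a := dS2 _ (X j).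
set e := enorm (_ - _) => d0 b0 a0 e0 b2 tri.
have {b2} be : b <= pi * e.
  by rewrite -(ler_pXn2r (ltn0Sn 1)) ?nnegrE ?exprMn// mulr_ge0// ltW.
apply: (@le_trans _ _ ((a + pi * e) ^+ 2)).
  by rewrite lerXn2r ?nnegrE//; nra.
rewrite -subr_ge0.
have -> : (1 + pi) * (a ^+ 2 + pi * e ^+ 2) - (a + pi * e) ^+ 2 =
  pi * (a - e) ^+ 2 by ring.
by rewrite mulr_ge0 ?sqr_ge0// ltW.
Qed.

End Comparison.

Theorem theorem3p4 (R : realType) (M n : nat) (hM : (1 <= M)%N) (hn : (1 <= n)%N)
    (Phi : 'I_M -> 'I_n -> 'cV[R]_3) (hPhi : forall i, spherical (Phi i))
    (g : 'I_M -> 'M[R]_3) (Theta : 'I_n -> 'cV[R]_3)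
    (hTheta : sphere_solution Phi g Theta)
    (g' : 'I_M -> 'M[R]_3) (Psi : 'I_n -> 'cV[R]_3)
    (hPsi : euclidean_solution Phi g' Psi)
    (hPsi0 : forall j, Psi j <> 0) :
  inf [set dS2n (act h Theta) (sphere_proj Psi) | h in O3]
    <= (1 + pi) * Num.sqrt (sphere_loss Phi g Theta).
Proof.
have [gSO TS _] := hTheta; have [g'O Pmin] := hPsi.
have gO i : O3 (g i) by have [] := gSO i.
have P0 j : Psi j != 0 by apply/eqP.
set D := [set _ | _ in _]; set L := sphere_loss _ _ _.
have D0 : lbound D 0 by move=> _ [h _ <-]; exact: sqrtr_ge0.
(* Nonnegativity allows the final inequality to be proved after squaring. *)
have inf0 : 0 <= inf D.
  by apply: lb_le_inf => //; exists (dS2n (act 1%:M Theta) (sphere_proj Psi));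
    exists 1%:M => //; exact: O3_1.
have M0 : 0 < M%:R :> R by rewrite ltr0n.
have pi0 := pi_gt0 R.
have EL : euclidean_loss Phi g' Psi <= L.
  exact: le_trans (Pmin _ _ gO) (euclidean_loss_le_sphere hPhi gO TS).
have L0 : 0 <= L.
  apply: mulr_ge0; first by rewrite invr_ge0 ltW.
  apply: sumr_ge0 => i _.
  by rewrite sumr_ge0// => j _; rewrite sqr_ge0.
have inf2 : inf D ^+ 2 <= (1 + pi) * (L + pi * euclidean_loss Phi g' Psi).
  (* Written as an average of [M] equal terms, the square can be bounded for each [i] by its own
     matrix [g' i *m (g i)^T]. *)
  have -> : inf D ^+ 2 = M%:R^-1 * \sum_(i < M) inf D ^+ 2.
    by rewrite sumr_const card_ord -[X in _ * X]mulr_natl mulKf// gt_eqF.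
  rewrite euclidean_lossE /L /sphere_loss (mulrCA pi) -mulrDr (mulrCA (1 + pi)).
  rewrite ler_wpM2l ?invr_ge0 ?(ltW M0)//.
  rewrite mulr_sumr -big_split/= mulr_sumr; apply: ler_sum => i _.
  apply: le_trans (dS2n_transfer_le hPhi i (gO i) (g'O i) TS P0).
  rewrite lerXn2r ?nnegrE ?sqrtr_ge0//; apply: ge_inf; first by exists 0.
  by exists (g' i *m (g i)^T) => //; apply: O3_mul => //; apply: O3_tr.
rewrite -(ler_pXn2r (ltn0Sn 1)) ?nnegrE ?mulr_ge0 ?sqrtr_ge0//; last by lra.
rewrite exprMn sqr_sqrtr//; apply: le_trans inf2 _.
(* By [EL] the second factor is at most [(1 + pi) * L], which supplies the other factor [1 + pi] of
   the square. *)
by rewrite expr2 -mulrA ler_wpM2l//; nra.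
Qed.
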